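(* Let $(L,\prec)$ be a proximity frame. Then, in the category $\mathbf{KPSp}$ of compact pospaces and continuous monotone maps, $\mathrm{End}(L)\cong\mathrm{Prim}(L)/{\equiv}$ via the map $$\sigma:\mathrm{Prim}(L)/{\equiv}\;\longrightarrow\;\mathrm{End}(L),\qquad x^{\equiv}\longmapsto {\Uparrow}x .$$
   Context: A frame is a complete lattice $L$ with $a\wedge\bigvee S=\bigvee\{a\wedge s\mid s\in S\}$ for all $a\in L$, $S\subseteq L$. A proximity frame is a pair $(L,\prec)$ with $L$ a frame and $\prec$ a binary relation on $L$ such that: (S1) $0\prec 0$ and $1\prec 1$; (S2) $a\prec b,c$ implies $a\prec b\wedge c$; (S3) $a,b\prec c$ implies $a\vee b\prec c$; (S4) $a\le b\prec c\le d$ implies $a\prec d$; (S5) $a=\bigvee\{b\in L\mid b\prec a\}$; (S6) $a\prec b$ implies $a\le b$; (S8) $a\prec b$ implies $a\prec c\prec b$ for some $c$. For $S\subseteq L$, ${\Uparrow}S=\{b\in L\mid\exists s\in S: s\prec b\}$. $\mathrm{Prim}(L)$ is the set of prime filters of $L$ ordered by inclusion, with the Priestley topology generated by the sets $\eta(a)=\{x\in\mathrm{Prim}(L)\mid a\in x\}$ and their complements, $a\in L$. It carries the relation $x\mathrel R y$ iff ${\Uparrow}x\subseteq y$, which is a closed pre-order. Put $x\equiv y$ iff $x\mathrel R y$ and $y\mathrel R x$ (equivalently ${\Uparrow}x={\Uparrow}y$), and write $x^{\equiv}$ for the class of $x$. $\mathrm{Prim}(L)/{\equiv}$ has the quotient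 topology and the order $x^{\equiv}\le_R y^{\equiv}$ iff $x\mathrel R y$; it is a compact pospace. A round filter of $L$ is a lattice filter $\mathfrak F$ with $\mathfrak F={\Uparrow}\mathfrak F$. An end is a round filter $p$ such that for all round filters $\mathfrak F_1,\mathfrak F_2$: $\mathfrak F_1\cap\mathfrak F_2\subseteq p$ iff $\mathfrak F_1\subseteq p$ or $\mathfrak F_2\subseteq p$. $\mathrm{End}(L)$ is the set of all ends of $L$. Let $\tau$ be the topology on $\mathrm{End}(L)$ generated by the sets $\mu(a)=\{p\in\mathrm{End}(L)\mid a\in p\}$, $a\in L$; it is stably compact. $\mathrm{End}(L)$ is regarded as a compact pospace with the patch topology of $\tau$ (generated by $\tau$ and the complements of the compact saturated sets of $\tau$) and the order $p\le q$ iff $p\in\mathrm{cl}_\tau(\{q\})$ (equivalently $p\subseteq q$). A compact pospace is a compact space $P$ with an order relation that is closed in $P^2$.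
   Formalization: Ends are required to be proper (p ≠ L), and prime filters are proper as usual; with the literal definition the improper filter L would be an end (it is round since 0 ≺ 0) that is not ⇑x for any proper prime filter x, so σ would not be onto. *)

(* Defs.v *)
From HB Require Import structures.
From mathcomp Require Import all_boot all_order.
From mathcomp Require Import all_classical.
From mathcomp Require Import topology.

Set Implicit Arguments.
Unset Strict Implicit.
Unset Printing Implicit Defensive.

Import Order.TTheory.

Local Open Scope classical_set_scope.
Local Open Scope quotient_scope.

HB.mixin Record isFrame (d : Order.disp_t) L & Order.TBLattice d L := {
  frame_sup : forall S : set L, exists s, supremums S s;
  frame_inf : forall S : set L, exists s, infimums S s;
  frame_meet_sup : forall (a : L) (S : set L) (s : L), supremums S s ->
    supremums [set Order.meet a t | t in S] (Order.meet a s)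
}.

#[short(type="frameType")]
HB.structure Definition Frame (d : Order.disp_t) :=
  { L of isFrame d L & Order.TBLattice d L }.

HB.mixin Record isProximityFrame (d : Order.disp_t) L & Frame d L := {
  prox : L -> L -> Prop;
  prox00 : prox (\bot)%O (\bot)%O;
  prox11 : prox (\top)%O (\top)%O;
  prox_meet : forall a b c, prox a b -> prox a c -> prox a (Order.meet b c);
  prox_join : forall a b c, prox a c -> prox b c -> prox (Order.join a b) c;
  le_prox_le : forall a b c e, (a <= b)%O -> prox b c -> (c <= e)%O ->
    prox a e;
  prox_sup : forall a, supremums [set b | prox b a] a;
  prox_le : forall a b, prox a b -> (a <= b)%O;
  prox_interpolation : forall a b, prox a b -> exists c, prox a c /\ prox c b
}.

#[short(type="proximityFrameType")]
HB.structure Definition ProximityFrame (d : Order.disp_t) :=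
  { L of isProximityFrame d L & Frame d L }.

Definition up_prox {d : Order.disp_t} {L : proximityFrameType d} (S : set L) :
  set L := [set b | exists2 s, S s & prox s b].

Section Filters.
Context {d : Order.disp_t} {L : tbLatticeType d}.

Definition lattice_filter (F : set L) : Prop :=
  [/\ F !=set0,
      forall a b, F a -> F b -> F (Order.meet a b) &
      forall a b, (a <= b)%O -> F a -> F b].

(* Prime filters are proper, so that [eta \bot] below is empty. *)
Definition prime_filter (F : set L) : Prop :=
  [/\ lattice_filter F, F <> [set: L] &
      forall a b, F (Order.join a b) -> F a \/ F b].

End Filters.

Record Prim (d : Order.disp_t) (L : tbLatticeType d) : Type := MkPrim {
  prim_set :> set L;
  prim_setP : prime_filter prim_set
}.

Section PriestleyTopology.
Context {d : Order.disp_t} {L : tbLatticeType d}.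

HB.instance Definition _ := gen_eqMixin (Prim L).
HB.instance Definition _ := gen_choiceMixin (Prim L).

Definition eta (a : L) : set (Prim L) := [set x | prim_set x a].

HB.instance Definition _ := isSubBaseTopological.Build (Prim L)
  (range eta `|` range (fun a => ~` eta a)) id.

End PriestleyTopology.

Section Quotient.
Context {d : Order.disp_t} {L : proximityFrameType d}.

Definition prim_rel (x y : Prim L) : Prop := up_prox x `<=` y.

Lemma prim_rel_refl x : prim_rel x x.
Proof.
move=> b [s xs sb]; have [[_ _ up] _ _] := prim_setP x.
exact: up _ _ (prox_le _ _ sb) xs.
Qed.

Lemma prim_rel_trans x y z : prim_rel x y -> prim_rel y z -> prim_rel x z.
Proof.
move=> xy yz b [s xs /prox_interpolation[c [sc cb]]].
by apply: yz; exists c => //; apply: xy; exists s.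
Qed.

Definition prim_equiv : rel (Prim L) :=
  fun x y => `[< prim_rel x y /\ prim_rel y x >].

Lemma prim_equiv_refl : reflexive prim_equiv.
Proof. by move=> x; apply/asboolP; split; exact: prim_rel_refl. Qed.

Lemma prim_equiv_sym : symmetric prim_equiv.
Proof. by move=> x y; apply/asboolP/asboolP => -[]. Qed.

Lemma prim_equiv_trans : transitive prim_equiv.
Proof.
move=> y x z /asboolP[xy yx] /asboolP[yz zy]; apply/asboolP.
by split; [exact: prim_rel_trans yz | exact: prim_rel_trans yx].
Qed.

Canonical prim_equiv_equiv :=
  EquivRel prim_equiv prim_equiv_refl prim_equiv_sym prim_equiv_trans.

End Quotient.

Definition PrimQuot (d : Order.disp_t) (L : proximityFrameType d) :=
  quotient_topology {eq_quot (@prim_equiv d L)}.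

Definition prim_class {d : Order.disp_t} {L : proximityFrameType d}
  (x : Prim L) : PrimQuot L := \pi x.

Definition le_R {d : Order.disp_t} {L : proximityFrameType d}
  (u v : PrimQuot L) : Prop := prim_rel (repr u) (repr v).

(* The order does not depend on the choice of representatives. *)
Lemma le_RE (d : Order.disp_t) (L : proximityFrameType d) (x y : Prim L) :
  le_R (prim_class x) (prim_class y) <-> prim_rel x y.
Proof.
have rE (z : Prim L) : prim_rel (repr (prim_class z)) z /\
    prim_rel z (repr (prim_class z)).
  by apply/asboolP/(eqquotP {eq_quot prim_equiv}); rewrite reprK.
have [rx xr] := rE x; have [ry yr] := rE y; split=> xy.
  exact: prim_rel_trans xr (prim_rel_trans xy ry).
exact: prim_rel_trans rx (prim_rel_trans xy yr).
Qed.

Section Ends.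
Context {d : Order.disp_t} {L : proximityFrameType d}.

Definition round_filter (F : set L) : Prop :=
  lattice_filter F /\ F = up_prox F.

(* Ends are proper: the improper filter [setT] is round and satisfies the
   equivalence vacuously, but it is not of the form [up_prox x] for a
   (proper) prime filter [x]. *)
Definition is_end (p : set L) : Prop :=
  [/\ round_filter p, p <> [set: L] &
      forall F1 F2 : set L, round_filter F1 -> round_filter F2 ->
        (F1 `&` F2 `<=` p <-> F1 `<=` p \/ F2 `<=` p)].

End Ends.

Record Ends (d : Order.disp_t) (L : proximityFrameType d) : Type := MkEnds {
  end_set : set L;
  end_setP : is_end end_set
}.

Section EndTopology.
Context {d : Order.disp_t} {L : proximityFrameType d}.

HB.instance Definition _ := gen_eqMixin (Ends L).
HB.instance Definition _ := gen_choiceMixin (Ends L).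

Definition mu (a : L) : set (Ends L) := [set p | end_set p a].

HB.instance Definition _ := isSubBaseTopological.Build (Ends L)
  (range mu) id.

End EndTopology.

Definition saturated {T : topologicalType} (A : set T) : Prop :=
  A = \bigcap_(U in [set U | open U /\ A `<=` U]) U.

Definition patch_topology (T : topologicalType) : Type := T.

Section PatchTopology.
Context {T : topologicalType}.

HB.instance Definition _ := Choice.on (patch_topology T).

HB.instance Definition _ := isSubBaseTopological.Build (patch_topology T)
  ([set U : set T | open U] `|`
   [set ~` K | K in [set K : set T | compact K /\ saturated K]]) id.

End PatchTopology.

(* The specialization order of the topology generated by the [mu a]; the
   closure is not taken in the patch topology. *)
Definition end_le {d : Order.disp_t} {L : proximityFrameType d}
  (p q : patch_topology (Ends L)) : Prop := @closure (Ends L) [set q] p.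

Record compact_pospace (P : topologicalType) (le : P -> P -> Prop) : Prop := {
  kpsp_refl : forall x, le x x;
  kpsp_anti : forall x y, le x y -> le y x -> x = y;
  kpsp_trans : forall x y z, le x y -> le y z -> le x z;
  kpsp_compact : compact [set: P];
  kpsp_closed : closed [set xy : P * P | le xy.1 xy.2]
}.

Arguments compact_pospace : clear implicits.

Definition kpsp_morphism (P Q : topologicalType) (leP : P -> P -> Prop)
    (leQ : Q -> Q -> Prop) (f : P -> Q) : Prop :=
  continuous f /\ (forall x y, leP x y -> leQ (f x) (f y)).

Arguments kpsp_morphism : clear implicits.

Definition kpsp_iso (P Q : topologicalType) (leP : P -> P -> Prop)
    (leQ : Q -> Q -> Prop) (f : P -> Q) : Prop :=
  [/\ compact_pospace P leP, compact_pospace Q leQ, kpsp_morphism P Q leP leQ f &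
      exists g : Q -> P, [/\ kpsp_morphism Q P leQ leP g, cancel f g & cancel g f]].

Arguments kpsp_iso : clear implicits.

(* Main.v *)
(** For a prime filter [x], [up_prox x] is an end; conversely, given an end [p],
    the elements [a] with [prox a b] for some [b] outside [p] form an ideal
    disjoint from [p], and any prime filter separating the two is mapped to [p].
    So [sigma] is a bijection that preserves and reflects the order. The space
    of prime filters is compact, and the map to ends is patch continuous since a
    compact saturated [K] missing [up_prox x] is covered by a single [mu b]
    with [b] outside [x]. The sets of ends containing [up_prox [set b]] are
    compact saturated and contain [mu b], hence the order on ends is closed and
    the patch topology is Hausdorff. A continuous bijection from a compact
    space to a Hausdorff space is a homeomorphism. *)

Require Import Defs.
From mathcomp Require Import all_boot all_order.
From mathcomp Require Import all_classical.
From mathcomp Require Import topology.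

Set Implicit Arguments.
Unset Strict Implicit.
Unset Printing Implicit Defensive.

Import Order.TTheory.

Local Open Scope classical_set_scope.
Local Open Scope quotient_scope.

(** * Convergence and continuity through a subbase *)

Section Subbase.
Context {T : topologicalType} (D : set (set T)).
Hypothesis openE : @open T =
  [set \bigcup_(A in E) A | E in [set E | E `<=` finI_from D id]].

Lemma subbase_open U : D U -> open U.
Proof.
move=> DU; rewrite openE; exists [set U]; last by rewrite bigcup_set1.
by move=> _ ->; apply: finI_from1.
Qed.

(** Every neighbourhood of [x] contains a finite intersection of subbasic sets around [x], and
    filters are closed under finite intersections. *)
Lemma subbase_cvg (F : set_system T) (x : T) : Filter F ->
  (forall U, D U -> U x -> F U) -> F --> x.
Proof.
move=> FF FD A; rewrite nbhsE => -[B [+ Bx] BA].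
rewrite openE => -[E ED BE]; move: Bx; rewrite -BE => -[V EV Vx].
have [D' D'D VE] := ED _ EV; apply: (@filterS _ F _ V).
  by apply: subset_trans BA; rewrite -BE; apply: bigcup_sup.
rewrite -VE; apply: filter_bigI => U D'U; apply: FD.
  by have := D'D _ D'U; rewrite inE.
by move: Vx; rewrite -VE; apply.
Qed.

Lemma subbase_continuous (S : topologicalType) (f : S -> T) :
  (forall U, D U -> open (f @^-1` U)) -> continuous f.
Proof.
move=> Df x; apply: subbase_cvg => U DU Ux.
by apply: open_nbhs_nbhs; split => //; exact: Df.
Qed.

End Subbase.

(** * Prime filter theorem for frames *)

Section PrimeFilters.
Context {d : Order.disp_t} {L : frameType d}.

Lemma frame_meetUr (a b c : L) :
  (Order.meet a (Order.join b c) <=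
   Order.join (Order.meet a b) (Order.meet a c))%O.
Proof.
have bcS : supremums [set b; c] (Order.join b c).
  split=> [x [->|->]|x xub]; [exact: leUl|exact: leUr|].
  by rewrite leUx; apply/andP; split; apply: xub; [left|right].
have [_] := frame_meet_sup a _ _ bcS; apply => _ [t [->|->] <-].
  exact: leUl.
exact: leUr.
Qed.

(** Zorn's lemma yields a filter maximal among those that contain [F] and miss [I]; distributivity
    of [L] makes it prime. *)
Lemma prime_filter_separation (F I : set L) : lattice_filter F ->
  I !=set0 -> (forall a b, (a <= b)%O -> I b -> I a) ->
  (forall a b, I a -> I b -> I (Order.join a b)) -> F `&` I = set0 ->
  exists x : Prim L, F `<=` x /\ x `&` I = set0.
Proof.
move=> [F0 FM FU] [i0 Ii0] ID IJ FI.
(* The union with [F] makes [P] hold for the empty chain. *)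
pose P X := lattice_filter (X `|` F) /\ (X `|` F) `&` I = set0.
have [C CP Ctot|M [[MF MI] Mmax]] := @Zorn_bigcup L P.
  split; [split|].
  - by have [a Fa] := F0; exists a; right.
  - move=> a b [[X CX Xa]|Fa] [[Y CY Yb]|Fb].
    + have [Z [CZ Za Zb]] : exists Z, [/\ C Z, Z a & Z b].
        have [XY|YX] := Ctot _ _ CX CY.
          by exists Y; split=> //; exact: XY.
        by exists X; split=> //; exact: YX.
      have [[_ ZM _] _] := CP _ CZ.
      by have [||?|?] := ZM a b; [left|left|left; exists Z|right].
    + have [[_ YM _] _] := CP _ CX.
      by have [||?|?] := YM a b; [left|right|left; exists X|right].
    + have [[_ YM _] _] := CP _ CY.
      by have [||?|?] := YM a b; [right|left|left; exists Y|right].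
    + by right; exact: FM.
  - move=> a b ab [[X CX Xa]|Fa]; last by right; exact: FU Fa.
    have [[_ _ YU] _] := CP _ CX.
    by have [|?|?] := YU _ _ ab; [left|left; exists X|right].
  - rewrite -subset0 => a [[[X CX Xa]|Fa] Ia]; last by rewrite -FI.
    by have [_ <-] := CP _ CX; split => //; left.
(* Otherwise the filter [N] generated by [a] and the maximal filter would still miss [I], against
   maximality. *)
have MX a : ~ (M `|` F) a -> exists2 m, (M `|` F) m & I (Order.meet m a).
  have [[m0 Mm0] MM MU] := MF.
  move=> Ma; apply: contrapT => nI.
  pose N := [set c | exists2 m, (M `|` F) m & (Order.meet m a <= c)%O].
  have MN : M `|` F `<=` N by move=> m Mm; exists m => //; exact: leIl.
  have NF : N `|` F = N.
    by apply/setUidPl => c Fc; apply: MN; right.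
  apply: (Mmax N).
    split; first by move=> m Mm; apply: MN; left.
    move=> NM; apply: Ma; left; apply: NM; exists m0 => //; exact: leIr.
  rewrite /P NF; split; [split|].
  - by exists m0; exact: MN.
  - move=> b c [m Mm mb] [n Mn nc]; exists (Order.meet m n); first exact: MM.
    by rewrite lexI (le_trans _ mb) ?(le_trans _ nc) // leI2 // ?leIl ?leIr.
  - by move=> b c bc [m Mm mb]; exists m => //; exact: le_trans bc.
  - rewrite -subset0 => b [[m Mm mb] Ib]; apply: nI; exists m => //.
    exact: ID Ib.
have Mprime : prime_filter (M `|` F).
  split => // [MT|a b Mab].
    by have : ((M `|` F) `&` I) i0; [split; rewrite ?MT|rewrite MI].
  have [_ MM MU] := MF.
  apply: contrapT => /not_orP[/MX[m Mm Ima] /MX[n Mn Inb]].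
  have : ((M `|` F) `&` I) (Order.meet (Order.meet m n) (Order.join a b)).
    split; first by apply: (MM) => //; exact: MM.
    apply: (ID _ _ (frame_meetUr _ _ _)); apply: IJ.
      by apply: (ID _ _ _ Ima); rewrite leI2 // leIl.
    by apply: (ID _ _ _ Inb); rewrite leI2 // leIr.
  by rewrite MI.
by exists (MkPrim Mprime); split => //= a Fa; right.
Qed.

End PrimeFilters.

(** * From prime filters to ends *)

Section PrimEnd.
Context {d : Order.disp_t} {L : proximityFrameType d}.
Implicit Types (x y : Prim L) (p q : Ends L) (a b : L).

Lemma prim_bot x : ~ prim_set x \bot%O.
Proof.
have [[_ _ xU] xT _] := prim_setP x => x0; apply: xT.
by apply/seteqP; split => // a _; exact: xU (le0x a) x0.
Qed.

Lemma up_prox_idem (S : set L) : up_prox (up_prox S) = up_prox S.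
Proof.
apply/seteqP; split => b [s].
  move=> [t St ts] sb; exists t => //.
  exact: le_prox_le (lexx _) ts (prox_le _ _ sb).
move=> Ss /prox_interpolation[c [sc cb]]; exists c => //; exists s => //.
Qed.

Lemma up_prox_subset (S1 S2 : set L) :
  S1 `<=` S2 -> up_prox S1 `<=` up_prox S2.
Proof. by move=> S12 b [s /S12 ? sb]; exists s. Qed.

Lemma up_prox_round (F : set L) :
  F !=set0 -> (forall a b, F a -> F b -> F (Order.meet a b)) ->
  round_filter (up_prox F).
Proof.
move=> [s Fs] FM; split; last by rewrite up_prox_idem.
split.
- by exists \top%O; exists s => //; apply: le_prox_le (lex1 _) prox11 _.
- move=> b c [t Ft tb] [u Fu uc]; exists (Order.meet t u); first exact: FM.
  apply: prox_meet; first by apply: le_prox_le (leIl _ _) tb _.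
  by apply: le_prox_le (leIr _ _) uc _.
- by move=> b c bc [t Ft tb]; exists t => //; apply: le_prox_le tb bc.
Qed.

Lemma up_prox_sub x : up_prox x `<=` x.
Proof.
move=> b [s xs /prox_le sb]; have [[_ _ xU] _ _] := prim_setP x.
exact: xU xs.
Qed.

(** If [a] in [F1] and [b] in [F2] lie outside [up_prox x], roundness gives [a'] and [b'] below them
    in the same filters. Their join belongs to both filters, hence to [x], and primeness of [x] then
    puts [a] or [b] in [up_prox x]. *)
Lemma up_prox_end x : is_end (up_prox x).
Proof.
have [[x0 xM xU] xT xP] := prim_setP x.
split; [exact: up_prox_round| |].
  move=> T; apply: (@prim_bot x); apply: up_prox_sub; rewrite T //.
move=> F1 F2 [[_ _ U1] R1] [[_ _ U2] R2]; split; last first.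
  by case=> Fx a [Fa Ga]; apply: Fx.
move=> F12; apply: contrapT => /not_orP[/existsNP[a /not_implyP[F1a xa]]].
move=> /existsNP[b /not_implyP[F2b xb]].
move: F1a F2b; rewrite R1 R2 => -[a' F1a' a'a] [b' F2b' b'b].
have : prim_set x (Order.join a' b').
  apply: up_prox_sub; apply: F12; split; [apply: U1 F1a'|apply: U2 F2b'].
    exact: leUl.
  exact: leUr.
by move=> /xP[xa'|xb']; [apply: xa; exists a'|apply: xb; exists b'].
Qed.

Definition prim_end x : Ends L := MkEnds (up_prox_end x).

Lemma end_inj p q : end_set p = end_set q -> p = q.
Proof.
case: p q => [p pP] [q qP] /= pq; move: qP; rewrite -pq => qP.
by rewrite (Prop_irrelevance pP qP).
Qed.

Lemma prim_end_surj p : exists x, prim_end x = p.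
Proof.
have [[pF pR] pT pP] := end_setP p; have [_ _ pU] := pF.
have pbot : ~ end_set p \bot%O.
  by move=> pb; apply: pT; apply/seteqP; split => // a _; exact: pU (le0x a) pb.
pose I := [set a | exists2 b, ~ end_set p b & prox a b].
have Rprox a : round_filter (up_prox [set a]).
  by apply: up_prox_round; [exists a|move=> b c -> ->; rewrite meetxx].
have [||||x [px xI]] := @prime_filter_separation d L (end_set p) I pF.
- by exists \bot%O; exists \bot%O => //; exact: prox00.
- by move=> a b ab [c pc bc]; exists c => //; apply: le_prox_le ab bc _.
(* The round filters generated by [a1] and [a2] are not included in [p], so neither is their
   intersection; any element [e] of it outside [p] witnesses that the join is in [I]. *)
- move=> a1 a2 [b1 pb1 ab1] [b2 pb2 ab2].
  have : ~ (up_prox [set a1] `&` up_prox [set a2] `<=` end_set p).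
    move=> /(pP _ _ (Rprox a1) (Rprox a2))[] /(_ _ _) sp.
      by apply/pb1/sp; exists a1.
    by apply/pb2/sp; exists a2.
  move=> /existsNP[e /not_implyP[[[_ -> a1e] [_ -> a2e]] pe]].
  by exists e => //; exact: prox_join.
- rewrite -subset0 => a [pa [b pb ab]]; apply: pb; rewrite pR.
  by exists a.
exists x; apply: end_inj => /=; rewrite [RHS]pR; apply/seteqP; split => b.
  move=> [s xs sb]; rewrite -pR; apply: contrapT => pb.
  by have : (prim_set x `&` I) s; [split=> //; exists b|rewrite xI].
exact: up_prox_subset.
Qed.

Lemma prim_rel_end x y :
  prim_rel x y <-> end_set (prim_end x) `<=` end_set (prim_end y).
Proof.
split=> [xy|xy]; last exact: subset_trans (@up_prox_sub y).
by rewrite /= -(up_prox_idem x); exact: up_prox_subset.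
Qed.

(** * Compactness of the prime filters and continuity of the map to ends *)

Lemma prim_openE : @open (Prim L) =
  [set \bigcup_(A in E) A | E in [set E |
    E `<=` finI_from (range eta `|` range (fun a => ~` eta a)) id]].
Proof. by []. Qed.

Lemma ends_openE : @open (Ends L) =
  [set \bigcup_(A in E) A | E in [set E | E `<=` finI_from (range mu) id]].
Proof. by []. Qed.

Lemma patch_openE (T : topologicalType) : @open (patch_topology T) =
  [set \bigcup_(A in E) A | E in [set E | E `<=` finI_from
    ([set U : set T | open U] `|`
     [set ~` K | K in [set K : set T | compact K /\ saturated K]]) id]].
Proof. by []. Qed.

Lemma eta_open a : open (eta a : set (Prim L)).
Proof. by apply: (subbase_open prim_openE); left; exists a. Qed.

Lemma etaC_open a : open (~` eta a : set (Prim L)).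
Proof. by apply: (subbase_open prim_openE); right; exists a. Qed.

Lemma mu_open a : open (mu a : set (Ends L)).
Proof. by apply: (subbase_open ends_openE); exists a. Qed.

Lemma prim_compact : compact [set: Prim L].
Proof.
rewrite compact_ultra => F FU _.
(* The limit of the ultrafilter [F]; maximality of [F] makes [x] prime and settles the complements
   of the sets [eta a]. *)
pose x := [set a | F (eta a)].
have xprime : prime_filter x.
  split; [split|move=> xT|].
  - exists \top%O; apply: filterS filterT => y _.
    by have [[[a ya] _ yU] _ _] := prim_setP y; exact: yU (lex1 a) ya.
  - move=> a b xa xb; apply: filterS (filterI xa xb) => y [ya yb].
    by have [[_ yM _] _ _] := prim_setP y; exact: yM.
  - move=> a b ab; apply: filterS => y ya.
    by have [[_ _ yU] _ _] := prim_setP y; exact: yU ya.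
  - have : x \bot%O by rewrite xT.
    by move=> /filter_ex[y /prim_bot].
  - move=> a b xab; have [|xa] := in_ultra_setVsetC (eta a) FU; first by left.
    right; apply: filterS (filterI xab xa) => y [yab ya].
    by have [_ _ yP] := prim_setP y; have [|] := yP _ _ yab.
exists (MkPrim xprime); split=> //.
apply: (subbase_cvg prim_openE) => _ [[a _ <-]//|[a _ <-]] xa.
by have [|//] := in_ultra_setVsetC (eta a) FU.
Qed.

Lemma prim_end_continuous : continuous (prim_end : Prim L -> Ends L).
Proof.
apply: (subbase_continuous ends_openE) => _ [a _ <-].
have -> : prim_end @^-1` mu a = \bigcup_(b in [set b | prox b a]) eta b.
  by apply/seteqP; split=> x [b ? ?]; exists b.
by apply: bigcup_open => b _; exact: eta_open.
Qed.

Lemma end_leE p q : end_le p q <-> end_set p `<=` end_set q.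
Proof.
split=> [pq a pa|pq B].
  have [|r [-> //]] := pq (mu a).
  by apply: open_nbhs_nbhs; split=> //; exact: mu_open.
move=> pB; exists q; split=> //.
(* Every subbasic neighbourhood of [p] contains [q], so the principal filter at [q] converges to
   [p]. *)
have : globally [set q] --> (p : Ends L).
  by apply: (subbase_cvg ends_openE) => _ [a _ <-] pa _ ->; exact: pq.
by move=> /(_ B pB); apply.
Qed.

Lemma saturated_up (K : set (Ends L)) p q :
  saturated K -> end_set p `<=` end_set q -> K p -> K q.
Proof.
move=> Ksat /end_leE pq Kp; rewrite Ksat => U [oU KU].
have [|r [-> //]] := pq U.
by apply: open_nbhs_nbhs; split=> //; exact: KU.
Qed.

(* If [K] were contained in no [mu b] with [b] outside [x], these sets
   [K `\` mu b] would generate a filter, and its cluster point in [K] would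
   lie below [prim_end x]. *)
Lemma compact_sub_mu (K : set (Ends L)) x :
  compact K -> saturated K -> ~ K (prim_end x) ->
  exists2 b, ~ prim_set x b & K `<=` mu b.
Proof.
move=> Kco Ksat Kx; apply: contrapT => nK.
have [_ _ xP] := prim_setP x.
pose F := filter_from [set b | ~ prim_set x b] (fun b => K `\` mu b).
have FF : ProperFilter F.
  apply: filter_from_proper; last first.
    move=> b xb; apply: contrapT => Kb; apply: nK; exists b => // p Kp.
    by apply: contrapT => pb; apply: Kb; exists p.
  apply: filter_from_filter; first by exists \bot%O; exact: prim_bot.
  move=> b c xb xc; exists (Order.join b c); first by move=> /xP[].
  move=> p [Kp pbc]; have [[[_ _ pU] _] _ _] := end_setP p.
  split; split=> // pb; apply: pbc; apply: pU pb; [exact: leUl|exact: leUr].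
have [|p [Kp pF]] := Kco F FF.
  by exists \bot%O; [exact: prim_bot|move=> p []].
have px : end_set p `<=` x.
  move=> b pb; apply: contrapT => xb.
  have [||q [[_ qb] /qb //]] := pF (K `\` mu b) (mu b); first by exists b.
  by apply: open_nbhs_nbhs; split=> //; exact: mu_open.
apply: Kx; apply: saturated_up Kp => //=.
by have [[_ ->] _ _] := end_setP p; exact: up_prox_subset.
Qed.

Lemma prim_end_patch_continuous :
  continuous (prim_end : Prim L -> patch_topology (Ends L)).
Proof.
apply: (@subbase_continuous (patch_topology (Ends L)) _ (@patch_openE _)).
move=> U [oU|[K [Kco Ksat] <-]].
  by have /continuousP := prim_end_continuous; apply.
(* The complement of [eta b] is a neighbourhood of [x] mapped outside [K]: if [up_prox y] is in [K],
   it contains [b], and so does [y]. *)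
rewrite openE => x /(compact_sub_mu Kco Ksat)[b xb Kb].
rewrite /interior; apply: (@filterS _ _ _ (~` eta b)).
  by move=> y yb /Kb /up_prox_sub.
by apply: open_nbhs_nbhs; split=> //; exact: etaC_open.
Qed.

(** * Patch-open separation of ends *)

Definition above b : set (Ends L) :=
  [set p | up_prox [set b] `<=` end_set p].

Lemma mu_above b : mu b `<=` above b.
Proof.
move=> p pb e [_ -> be]; have [[_ ->] _ _] := end_setP p.
by exists b.
Qed.

(** The set is the continuous image of an intersection of closed sets [eta e] in the compact space
    of prime filters. *)
Lemma above_compact b : compact (above b).
Proof.
have -> : above b = prim_end @` \bigcap_(e in up_prox [set b]) eta e.
  apply/seteqP; split=> [p|_ [x xb <-]].
    have [x <-] := prim_end_surj p => xb; exists x => // e be.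
    by apply: up_prox_sub; exact: xb.
  by rewrite /above /= -up_prox_idem; exact: up_prox_subset.
apply: continuous_compact.
  exact/continuous_subspaceT/prim_end_continuous.
apply: subclosed_compact prim_compact _ => //.
apply: closed_bigI => e _; rewrite -openC; exact: etaC_open.
Qed.

Lemma above_saturated b : saturated (above b).
Proof.
apply/seteqP; split=> [p pb U [_]|p pb e be]; first exact.
by apply: (pb (mu e)); split; [exact: mu_open|move=> q; apply].
Qed.

Lemma mu_patch_open b : open (mu b : set (patch_topology (Ends L))).
Proof.
apply: (@subbase_open (patch_topology (Ends L)) _ (@patch_openE _)).
by left; exact: mu_open.
Qed.

Lemma aboveC_patch_open b :
  open (~` above b : set (patch_topology (Ends L))).
Proof.
apply: (@subbase_open (patch_topology (Ends L)) _ (@patch_openE _)).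
right; exists (above b) => //.
by split; [exact: above_compact|exact: above_saturated].
Qed.

(** Take [a] in [p] but not in [q]; roundness of [p] provides [b] in [p] with [prox b a]. *)
Lemma end_separation p q : ~ end_set p `<=` end_set q ->
  exists2 b, mu b p & ~ above b q.
Proof.
move=> /existsNP[a /not_implyP[pa qa]].
have [[_ pR] _ _] := end_setP p; move: (pa); rewrite pR => -[b pb ba].
by exists b => // qb; apply: qa; apply: qb; exists b.
Qed.

Lemma end_le_closed : closed [set pq : patch_topology (Ends L) *
  patch_topology (Ends L) | end_le pq.1 pq.2].
Proof.
rewrite -openC openE => -[p q] /= pq.
have [|b pb qb] := @end_separation p q; first by move=> /end_leE.
exists (mu b, ~` above b) => /=.
  split; apply: (@open_nbhs_nbhs (patch_topology (Ends L))); split=> //.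
    exact: mu_patch_open.
  exact: aboveC_patch_open.
move=> [r s] /= [rb sb] /end_leE rs; apply: sb; apply: mu_above.
exact: rs.
Qed.

Lemma patch_hausdorff : hausdorff_space (patch_topology (Ends L)).
Proof.
(* For distinct ends at least one of the two inclusions fails, so separating along a failed
   inclusion suffices. *)
suff sep p q : ~ end_set p `<=` end_set q ->
    exists AB : set (Ends L) * set (Ends L), [/\ AB.1 p, AB.2 q,
      open (AB.1 : set (patch_topology (Ends L))),
      open (AB.2 : set (patch_topology (Ends L))) & AB.1 `&` AB.2 = set0].
  rewrite open_hausdorff => p q /eqP pq.
  have [/sep[[A B] /= [Ap Bq oA oB AB]]|pq'] :=
      pselect (~ end_set p `<=` end_set q).
    exists (A, B); first by rewrite !inE.
    by split=> //; apply/eqP.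
  have [/sep[[A B] /= [Aq Bp oA oB AB]]|qp'] :=
      pselect (~ end_set q `<=` end_set p).
    exists (B, A); first by rewrite !inE.
    by split=> //; apply/eqP; rewrite setIC.
  exfalso; apply: pq; apply: end_inj.
  by apply/seteqP; split; exact: contrapT.
move=> /end_separation[b pb qb]; exists (mu b, ~` above b); split=> //.
- exact: mu_patch_open.
- exact: aboveC_patch_open.
- by apply/disjoints_subset; rewrite setCK; exact: mu_above.
Qed.

End PrimEnd.

(** * The isomorphism of compact pospaces *)

Lemma compact_hausdorff_inverse (S T : topologicalType) (f : S -> T)
    (g : T -> S) : compact [set: S] -> hausdorff_space T -> continuous f ->
  cancel f g -> cancel g f -> continuous g.
Proof.
move=> Sco Th fc fK gK; apply/continuous_closedP => A cA.
have -> : g @^-1` A = f @` A.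
  by apply/seteqP; split=> [y Ay|_ [x Ax <-]] /=; [exists (g y)|rewrite fK].
apply: compact_closed => //; apply: continuous_compact.
  exact: continuous_subspaceT.
exact: subclosed_compact Sco _.
Qed.

Theorem theorem3p8 (d : Order.disp_t) (L : proximityFrameType d) :
  exists sigma : PrimQuot L -> patch_topology (Ends L),
    (forall x : Prim L, end_set (sigma (prim_class x)) = up_prox (prim_set x))
    /\ kpsp_iso (PrimQuot L) (patch_topology (Ends L)) le_R end_le sigma.
Proof.
(* Defined on chosen representatives; [sigmaE] shows independence of the choice. *)
pose sigma (u : PrimQuot L) : patch_topology (Ends L) := prim_end (repr u).
have classK (u : PrimQuot L) : prim_class (repr u) = u by exact: reprK.
have leE u v : le_R u v <-> end_le (sigma u) (sigma v).
  by rewrite end_leE; exact: prim_rel_end.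
have sigmaE x : sigma (prim_class x) = prim_end x.
  have /asboolP[rx xr] : prim_equiv (repr (prim_class x)) x.
    by apply/(eqquotP {eq_quot prim_equiv}); rewrite reprK.
  by apply/end_inj/seteqP; split; exact/prim_rel_end.
have sigma_inj u v : end_set (sigma u) = end_set (sigma v) -> u = v.
  rewrite -(classK u) -(classK v) !sigmaE => uv.
  apply/(eqquotP {eq_quot prim_equiv})/asboolP.
  by split; apply/prim_rel_end; rewrite uv.
have class_continuous : continuous (prim_class : Prim L -> PrimQuot L).
  exact: pi_continuous.
have sigma_continuous : continuous sigma.
  apply/quotient_continuous.
  have -> : sigma \o \pi_(PrimQuot L) = prim_end by apply/funext.
  exact: prim_end_patch_continuous.
have class_surj : prim_class @` [set: Prim L] = [set: PrimQuot L].
  by apply/seteqP; split=> // u _; exists (repr u).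
have quot_compact : compact [set: PrimQuot L].
  rewrite -class_surj; apply: continuous_compact prim_compact.
  exact: continuous_subspaceT.
have sigma_surj p : exists u, sigma u = p.
  by have [x <-] := prim_end_surj p; exists (prim_class x).
have [g gK] := choice sigma_surj.
have sigmaK : cancel sigma g by move=> u; apply: sigma_inj; rewrite gK.
exists sigma; split; first by move=> x; rewrite sigmaE.
split.
- split=> [u|u v|u v w||].
  + by apply/leE/end_leE.
  + move=> /leE/end_leE uv /leE/end_leE vu.
    by apply/sigma_inj/seteqP.
  + move=> /leE/end_leE uv /leE/end_leE vw.
    by apply/leE/end_leE; exact: subset_trans vw.
  + exact: quot_compact.
  (* Since [sigma] preserves and reflects the order, the graph of [le_R] is the preimage of the
     closed graph of [end_le] under the continuous map [s2]. *)
  + pose s2 (uv : PrimQuot L * PrimQuot L) := (sigma uv.1, sigma uv.2).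
    have -> : [set uv : PrimQuot L * PrimQuot L | le_R uv.1 uv.2] =
        s2 @^-1` [set pq | end_le pq.1 pq.2].
      by apply/seteqP; split=> -[u v] /leE.
    apply: preimage_closed end_le_closed => uv _.
    apply: (@cvg_pair _ _ _ _ (nbhs (sigma uv.1)) (nbhs (sigma uv.2))).
      apply: (@continuous_comp _ _ _ fst sigma); [exact: cvg_fst|].
      exact: sigma_continuous.
    apply: (@continuous_comp _ _ _ snd sigma); [exact: cvg_snd|].
    exact: sigma_continuous.
- split=> [p|p q|p q r||].
  + exact/end_leE.
  + by move=> /end_leE pq /end_leE qp; apply/end_inj/seteqP.
  + by move=> /end_leE pq /end_leE qr; apply/end_leE; exact: subset_trans qr.
  (* Patch compactness is inherited from the quotient, of which the space of ends is a continuous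
     image. *)
  + have -> : [set: patch_topology (Ends L)] = sigma @` [set: PrimQuot L].
      by apply/seteqP; split=> // p _; exists (g p).
    apply: continuous_compact quot_compact.
    exact: continuous_subspaceT.
  + exact: end_le_closed.
- by split=> // u v /leE.
exists g; split=> //; split.
  apply: compact_hausdorff_inverse quot_compact _ sigma_continuous _ _ => //.
  exact: patch_hausdorff.
by move=> p q pq; apply/leE; rewrite !gK.
Qed.
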